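(* For every integer $r\ge 2$, the generalised H-graph $H^5(r)$ satisfies $\chi_\rho(H^5(r))=6$.
   Context: All graphs are simple; $d_G(u,v)$ is the shortest-path distance. A packing $k$-colouring of $G$ is a map $\pi:V(G)\to\{1,\dots,k\}$ such that for distinct $u,v$, $\pi(u)=\pi(v)=i$ implies $d_G(u,v)>i$; $\chi_\rho(G)$ is the least $k$ for which a packing $k$-colouring exists. For integers $r\ge 2$ and $\ell\ge 1$, the generalised H-graph $H^\ell(r)$ has vertex set $\{u^i_j: 0\le i\le \ell+1,\ 0\le j\le 2r-1\}$ and edge set consisting of: $u^0_ju^0_{j+1}$ and $u^{\ell+1}_ju^{\ell+1}_{j+1}$ for $0\le j\le 2r-1$ (subscripts modulo $2r$); $u^i_{2j}u^i_{2j+1}$ for $1\le i\le \ell$, $0\le j\le r-1$; and $u^i_ju^{i+1}_j$ for $0\le i\le \ell$, $0\le j\le 2r-1$. *)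

(* Defs.v *)
From mathcomp Require Import all_boot.

Set Implicit Arguments.
Unset Strict Implicit.
Unset Printing Implicit Defensive.

Record sgraph := SGraph {
  vertex :> finType;
  adj : rel vertex;
  adj_sym : symmetric adj;
  adj_irrefl : irreflexive adj }.
Arguments adj {s} _ _.

Definition has_path (G : sgraph) (n : nat) (u v : G) : bool :=
  [exists p : n.-tuple G,
     [&& path adj u p, uniq (u :: p) & last u p == v]].

(* A path has fewer than #|G| edges, so searching lengths below #|G| is
   exhaustive; None stands for infinite distance (u and v not connected). *)
Definition gdist (G : sgraph) (u v : G) : option nat :=
  ohead [seq n <- iota 0 #|G| | has_path n u v].

Lemma gdistP (G : sgraph) (u v : G) n :
  gdist u v = Some n <-> has_path n u v /\ forall m, has_path m u v -> n <= m.
Proof.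
have bd m : has_path m u v -> m < #|G|.
  case/existsP=> p /and3P[_ /card_uniqP e _].
  by have := max_card (mem (u :: p)); rewrite e /= size_tuple.
rewrite /gdist; set P := fun n => has_path n u v.
have srt : sorted ltn (filter P (iota 0 #|G|)).
  by apply: sorted_filter; [exact: ltn_trans | exact: iota_ltn_sorted].
have memP m : (m \in filter P (iota 0 #|G|)) = P m.
  rewrite mem_filter mem_iota /= add0n; case h: (P m) => //=; exact: bd.
case: (filter P _) srt memP => [|a s] /= srt memP.
  by split=> // -[h _]; have := memP n; rewrite /P h.
have mn m : P m -> a <= m.
  rewrite -memP inE => /orP[/eqP->//|ms].
  by move: srt; rewrite (path_sortedE ltn_trans) => /andP[/allP/(_ _ ms)/ltnW].
have Pa : P a by rewrite -memP mem_head.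
split=> [[<-]|[h1 h2]]; first by [].
by congr Some; apply/eqP; rewrite eqn_leq mn //= h2.
Qed.

Definition gdist_gt (G : sgraph) (u v : G) (i : nat) : bool :=
  if gdist u v is Some d then i < d else true.

(* Colours 1, ..., k are the nonzero elements of 'I_k.+1. *)
Definition packing_colouring (G : sgraph) (k : nat)
    (f : {ffun G -> 'I_k.+1}) : bool :=
  [forall u, 0 < f u] &&
  [forall u, forall v, (u != v) && (f u == f v) ==> gdist_gt u v (f u)].

Definition packing_colourable (G : sgraph) (k : nat) : bool :=
  [exists f : {ffun G -> 'I_k.+1}, packing_colouring f].

Lemma packing_colourable_ex (G : sgraph) : exists k, packing_colourable G k.
Proof.
exists #|G|; apply/existsP; exists [ffun u => lift ord0 (enum_rank u)].
apply/andP; split; first by apply/forallP => u; rewrite ffunE.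
apply/forallP => u; apply/forallP => v; apply/implyP; rewrite !ffunE.
by case/andP => /eqP uv /eqP /lift_inj /enum_rank_inj.
Qed.

Definition packing_chromatic_number (G : sgraph) : nat :=
  ex_minn (packing_colourable_ex G).

Section GeneralisedHGraph.
Variables l r : nat.

(* The pair (i, j) is the vertex u^i_j. *)
Definition H_vertex : finType := ('I_l.+2 * 'I_(2 * r))%type.

(* The listed edges, each with the orientation in which it is written. *)
Definition H_arc (x y : H_vertex) : bool :=
  [|| [&& x.1 == y.1, (x.1 == 0 :> nat) || (x.1 == l.+1 :> nat)
        & y.2 == x.2.+1 %% (2 * r) :> nat],
      [&& x.1 == y.1, 1 <= x.1 <= l
        & [exists j : 'I_r, (x.2 == 2 * j :> nat) && (y.2 == (2 * j).+1 :> nat)]]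
    | (y.1 == x.1.+1 :> nat) && (x.2 == y.2)].

Definition H_adj (x y : H_vertex) : bool := H_arc x y || H_arc y x.

Lemma H_adj_sym : symmetric H_adj.
Proof. by move=> x y; rewrite /H_adj orbC. Qed.

Lemma H_adj_irrefl : irreflexive H_adj.
Proof.
move=> [i j]; rewrite /H_adj orbb /H_arc /= eqxx /=.
apply/negbTE; rewrite !negb_or; apply/and3P; split.
- rewrite negb_and; apply/orP; right; apply/negP => /eqP.
  have := ltn_ord j; rewrite leq_eqVlt => /orP[/eqP e|lt].
    rewrite e modnn => j0; move: (congr1 odd e).
    by rewrite j0 oddM.
  by rewrite modn_small // => /n_Sn.
- rewrite negb_and; apply/orP; right.
  by apply/negP => /existsP[k /andP[/eqP -> /eqP /n_Sn]].
- by apply/negP => /andP[/eqP /n_Sn].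
Qed.

Definition H_graph : sgraph := SGraph H_adj_sym H_adj_irrefl.

End GeneralisedHGraph.

(* Main.v *)
(** [H^5(r)] is a cyclic chain of [r] ladders (the two columns [2t] and [2t+1]),
    consecutive ladders being joined only along the top and the bottom row, and
    it is covered by the analogous infinite strip.  Packing constraints are
    therefore local.

    Lower bound: an exhaustive search shows that four consecutive ladders have
    no 5-colouring, even when only the constraints inside a ladder and between
    adjacent ladders are imposed; this makes sense in [H^5(r)] for all [r >= 2].

    Upper bound: distances at most 6 span at most four consecutive ladders, so
    a cyclic word of ladder colourings is a packing 6-colouring as soon as all
    its windows of four letters are good.  Words of length 2, 4 and 5 are given
    explicitly; the other lengths are [3k], [3k+7] and [3k+8], obtained by
    repeating a block of three ladders in front of tails that start with the
    same block. *)
Require Import Defs.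
From mathcomp Require Import all_boot.
From mathcomp Require Import zify.

Set Implicit Arguments.
Unset Strict Implicit.
Unset Printing Implicit Defensive.

(** * The infinite strip and its projection onto [H^5(r)] *)

Definition strip_arc (p q : nat * nat) : bool :=
  ((p.1 == q.1) && [|| p.1 == 0, p.1 == 6 | ~~ odd p.2] && (q.2 == p.2.+1))
  || ((q.1 == p.1.+1) && (p.2 == q.2)).

(** In row or column 0 the truncated predecessor gives back [p], which the arc test rejects. The
    vertical arcs have no upper end, hence the test [q.1 < 7]. *)
Definition strip_nbrs (p : nat * nat) : seq (nat * nat) :=
  [seq q <- [:: (p.1.+1, p.2); (p.1.-1, p.2); (p.1, p.2.+1); (p.1, p.2.-1)]
     | (q.1 < 7) && (strip_arc p q || strip_arc q p)].

Fixpoint ball (n : nat) (p : nat * nat) : seq (nat * nat) :=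
  if n is m.+1 then
    let b := ball m p in undup (b ++ flatten [seq strip_nbrs q | q <- b])
  else [:: p].

Lemma modnSml (m d : nat) : (m %% d).+1 %% d = m.+1 %% d.
Proof. by rewrite -addn1 modnDml addn1. Qed.

(* [p] is a point of the strip above [u], counted from column [2 * t]; the offset
   leaves room on the left, as columns of the strip are natural numbers. *)
Definition lift_of (r t : nat) (u : H_graph 5 r) (p : nat * nat) : bool :=
  (u.1 == p.1 :> nat) && (u.2 == (p.2 + 2 * t) %% (2 * r) :> nat).

(** An even column is at most [2 * r - 2], so the successor never wraps in the inner rows and one
    modular formula serves all rows. *)
Lemma H_arcE (r : nat) (u v : H_vertex 5 r) :
  H_arc u v = (u.1 == v.1) && [|| u.1 == 0 :> nat, u.1 == 6 :> nat | ~~ odd u.2]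
                && (v.2 == u.2.+1 %% (2 * r) :> nat)
              || (v.1 == u.1.+1 :> nat) && (u.2 == v.2).
Proof.
rewrite /H_arc orbA; congr (_ || _); case: (u.1 == v.1) => //=.
have -> : [exists j : 'I_r, (u.2 == 2 * j :> nat) && (v.2 == (2 * j).+1 :> nat)]
        = ~~ odd u.2 && (v.2 == u.2.+1 %% (2 * r) :> nat).
  apply/existsP/andP => [[j /andP[/eqP uj /eqP vj]]|[u_even /eqP vu]].
    rewrite uj vj oddM modn_small; last by have := ltn_ord v.2; rewrite vj.
    by split.
  have u2 : 2 * u.2./2 = u.2 by rewrite mul2n -[RHS]odd_double_half (negbTE u_even).
  have lt_u : u.2./2 < r by have := ltn_ord u.2; rewrite -[X in X < _]u2 ltn_mul2l.
  exists (Ordinal lt_u); rewrite /= u2 eqxx vu modn_small //=.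
  by move: (u.2./2) u2 lt_u => h <-; lia.
have := ltn_ord u.1; case: (nat_of_ord u.1) => [|[|[|[|[|[|[|]]]]]]] //= _.
all: by rewrite ?orbF.
Qed.

Section StripLift.
Variables r t : nat.
Hypothesis r_gt0 : 0 < r.
Implicit Types (u v : H_graph 5 r) (p q : nat * nat).

Lemma lift_of_odd u p : lift_of t u p -> odd u.2 = odd p.2.
Proof.
by case/andP=> _ /eqP->; rewrite odd_mod ?oddM // oddD oddM addbF.
Qed.

Lemma lift_of_exists p : p.1 < 7 -> exists u, lift_of t u p.
Proof.
move=> lt_p; have lt_m : (p.2 + 2 * t) %% (2 * r) < 2 * r by rewrite ltn_pmod ?muln_gt0.
by exists (Ordinal lt_p, Ordinal lt_m); rewrite /lift_of /= !eqxx.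
Qed.

Lemma lift_of_inj u v p : lift_of t u p -> lift_of t v p -> u = v.
Proof.
case: u v => [u1 u2] [v1 v2] /andP[/eqP/= up1 /eqP/= up2] /andP[/eqP/= vp1 /eqP/= vp2].
by congr pair; apply: val_inj; rewrite /= ?up1 ?up2 ?vp1 ?vp2.
Qed.

Lemma lift_of_lt u p : lift_of t u p -> p.1 < 7.
Proof. by case/andP=> /eqP<- _; exact: ltn_ord. Qed.

Lemma lift_of_arc u v p q : lift_of t u p -> lift_of t v q -> strip_arc p q -> H_arc u v.
Proof.
move=> up vq; rewrite H_arcE /strip_arc (lift_of_odd up).
case/andP: up vq => /eqP up1 /eqP up2 /andP[/eqP vq1 /eqP vq2].
rewrite -!val_eqE /= up1 up2 vq1 vq2.
case/orP=> [/andP[/andP[/eqP-> ->] /eqP->]|/andP[/eqP-> /eqP->]].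
  by rewrite eqxx modnSml addSn eqxx.
by rewrite !eqxx orbT.
Qed.

Lemma lift_of_adj u v p q : lift_of t u p -> lift_of t v q -> q \in strip_nbrs p -> H_adj u v.
Proof.
move=> up vq; rewrite mem_filter -andbA => /and3P[_ /orP[pq|qp] _].
  by rewrite /H_adj (lift_of_arc up vq).
by rewrite /H_adj (lift_of_arc vq up) ?orbT.
Qed.

(** Local lifting of edges. Column 0 is excluded because its left neighbour is missing from the
    strip. *)
Lemma lift_of_adj_lift u v p : 0 < p.2 -> lift_of t u p -> H_adj u v ->
  exists2 q, q \in strip_nbrs p & lift_of t v q.
Proof.
move=> p_gt0 up uv; have odd_up := lift_of_odd up.
suff [q pq [vq strip_pq]] : exists2 q,
    q \in [:: (p.1.+1, p.2); (p.1.-1, p.2); (p.1, p.2.+1); (p.1, p.2.-1)]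
    & lift_of t v q /\ strip_arc p q || strip_arc q p.
  by exists q => //; rewrite mem_filter (lift_of_lt vq) strip_pq pq.
have /andP[/eqP up1 /eqP up2] := up.
case/orP: uv; rewrite H_arcE -!val_eqE /=.
  case/orP=> [/andP[/andP[/eqP uv1 cond] /eqP v2]|/andP[/eqP v1 /eqP uv2]].
    exists (p.1, p.2.+1); first by rewrite !inE eqxx !orbT.
    rewrite /strip_arc /lift_of /= -uv1 up1 !eqxx v2 up2 -odd_up -up1 cond /=.
    by rewrite modnSml addSn eqxx.
  exists (p.1.+1, p.2); first by rewrite !inE eqxx.
  by rewrite /strip_arc /lift_of /= v1 up1 -uv2 up2 !eqxx !orbT.
case/orP=> [/andP[/andP[/eqP vu1 cond] /eqP u2]|/andP[/eqP u1 /eqP vu2]].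
  exists (p.1, p.2.-1); first by rewrite !inE eqxx !orbT.
  have v2 : v.2 = (p.2.-1 + 2 * t) %% (2 * r) :> nat.
    (* Adding 1 to both sides avoids a predecessor modulo [2 * r]. *)
    have : v.2 + 1 == (p.2.-1 + 2 * t) + 1 %[mod 2 * r].
      by apply/eqP; rewrite addn1 -u2 up2; congr (_ %% _); lia.
    by rewrite eqn_modDr => /eqP <-; rewrite modn_small.
  have vq : lift_of t v (p.1, p.2.-1) by rewrite /lift_of /= vu1 up1 v2 !eqxx.
  split => //; apply/orP; right.
  by rewrite /strip_arc /= -(lift_of_odd vq) -up1 -vu1 cond prednK ?eqxx.
exists (p.1.-1, p.2); first by rewrite !inE eqxx !orbT.
by rewrite /strip_arc /lift_of /= -up1 u1 vu2 up2 !eqxx !orbT.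
Qed.

Lemma ball_refl n p : p \in ball n p.
Proof.
elim: n => [|n IHn]; first by rewrite inE.
by rewrite [ball _ _]/= mem_undup mem_cat IHn.
Qed.

Lemma ball_step n p q q' : q \in ball n p -> q' \in strip_nbrs q -> q' \in ball n.+1 p.
Proof.
move=> pq qq'; rewrite [ball _ _]/= mem_undup mem_cat; apply/orP; right.
by apply/flatten_mapP; exists q.
Qed.

Lemma ball_col n p q : q \in ball n p -> p.2 <= q.2 + n.
Proof.
elim: n q => [|n IHn] q; first by rewrite inE => /eqP->; rewrite addn0.
rewrite [ball _ _]/= mem_undup mem_cat => /orP[/IHn|/flatten_mapP[q' /IHn]]; first by lia.
rewrite mem_filter => le_pq' /andP[_]; rewrite !inE.
by case/or4P=> /eqP-> /=; lia.
Qed.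

Lemma ball_row n p q : p.1 < 7 -> q \in ball n p -> q.1 < 7.
Proof.
move=> lt_p; elim: n q => [|n IHn] q; first by rewrite inE => /eqP->.
rewrite [ball _ _]/= mem_undup mem_cat => /orP[/IHn//|/flatten_mapP[q' _]].
by rewrite mem_filter => /andP[/andP[]].
Qed.

(** Walks lift edge by edge. Each edge moves at most one column to the left, so [size s <= p.2]
    keeps every point from which a step is taken off column 0. *)
Lemma ball_path u p (s : seq (H_graph 5 r)) : lift_of t u p -> size s <= p.2 ->
  path (@H_adj 5 r) u s -> exists2 q, q \in ball (size s) p & lift_of t (last u s) q.
Proof.
move=> up; elim/last_ind: s => [|s v IHs]; first by exists p; rewrite ?ball_refl.
rewrite size_rcons rcons_path last_rcons => le_s /andP[us sv].
have [q pq sq] := IHs (ltnW le_s) us.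
have q_gt0 : 0 < q.2 by rewrite -(ltn_add2r (size s)) (leq_trans le_s) // ball_col.
have [q' qq' vq'] := lift_of_adj_lift q_gt0 sq sv.
by exists q' => //; exact: ball_step qq'.
Qed.

(** Conversely, walks in the strip project to walks. Truncation at column 0 only shrinks balls,
    which is harmless in this direction. *)
Lemma path_ball u v p q n : lift_of t u p -> lift_of t v q -> q \in ball n p ->
  exists s, [/\ path (@H_adj 5 r) u s, last u s = v & size s <= n].
Proof.
move=> up; elim: n v q => [|n IHn] v q vq.
  by rewrite inE => /eqP qp; exists [::]; split=> //; apply: lift_of_inj up _; rewrite -qp.
rewrite [ball _ _]/= mem_undup mem_cat => /orP[/(IHn _ _ vq)[s [us sv le_s]]|].
  by exists s; split=> //; exact: leqW.
case/flatten_mapP=> q' pq' q'q.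
have [v' vq'] := lift_of_exists (ball_row (lift_of_lt up) pq').
have [s [us sv' le_s]] := IHn _ _ vq' pq'.
exists (rcons s v); rewrite rcons_path us last_rcons size_rcons sv' /=; split=> //.
exact: lift_of_adj vq' vq q'q.
Qed.

End StripLift.

(** * Ladder colourings and the window condition *)

(* A ladder colouring is listed row by row: entry [2 * i + b] is the colour of the
   vertex in row [i] of the even ([b = 0]) or odd ([b = 1]) column. *)
Definition ladder_col (w : seq nat) (p : nat * nat) : nat :=
  nth 0 w (2 * p.1 + p.2 %% 2).

Definition ladder_pt (k n : nat) : nat * nat := (n./2, 2 * k + n %% 2).

(* Only constraints from the first ladder towards the right are tested; those
   towards the left follow by [ball_mirror].  The first ladder is put in columns
   6 and 7 so that balls of radius 6 are not truncated at column 0. *)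
Definition window_ok (a b c d : seq nat) : bool :=
  all (fun n => let p := ladder_pt 3 n in let k := ladder_col a p in
    (0 < k <= 6) &&
    all (fun q => [|| q.2 < 6, q == p |
        ladder_col (nth [::] [:: a; b; c; d] (q.2 %/ 2 - 3)) q != k]) (ball k p))
  (iota 0 14).

(** Symmetry of the strip distance, combined with a translation by whole ladders that brings [q] to
    columns 6 and 7. With radii at most 6 and centres in one ladder this is a finite check. *)
Lemma ball_mirror_computed :
  all (fun m => all (fun n => let p := ladder_pt 3 n in
    all (fun q => (6 <= q.2) ||
       ((p.1, p.2 + (6 - 2 * (q.2 %/ 2))) \in
           ball m (q.1, q.2 + (6 - 2 * (q.2 %/ 2)))))
     (ball m p)) (iota 0 14)) (iota 0 7).
Proof. by vm_cast_no_check (erefl true). Qed.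

(** * Good cyclic words of every length [r >= 2] *)

(* The words below were found by computer search. *)
Definition word2 : seq (seq nat) :=
[:: [:: 1; 2; 4; 1; 1; 3; 2; 1; 1; 6; 5; 1; 1; 2];
  [:: 1; 3; 5; 1; 1; 6; 3; 1; 1; 2; 4; 1; 1; 3]].

Definition ladder0 := [:: 1; 4; 3; 1; 1; 5; 2; 1; 4; 6; 3; 1; 1; 2].
Definition ladder1 := [:: 1; 3; 2; 1; 1; 6; 5; 1; 1; 2; 3; 1; 1; 4].
Definition ladder2 := [:: 1; 2; 5; 1; 2; 3; 1; 4; 6; 1; 3; 2; 1; 5].
Definition word3 : seq (seq nat) := [:: ladder0; ladder1; ladder2].

Definition word5 : seq (seq nat) :=
[:: [:: 1; 2; 5; 1; 2; 3; 4; 1; 1; 2; 3; 1; 2; 5];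
  [:: 1; 4; 3; 2; 1; 5; 2; 1; 1; 6; 3; 1; 1; 2];
  [:: 1; 3; 2; 1; 1; 5; 3; 1; 1; 2; 4; 1; 1; 3];
  [:: 1; 2; 6; 1; 1; 3; 2; 1; 1; 4; 5; 1; 1; 2];
  [:: 1; 3; 4; 1; 1; 2; 5; 1; 2; 3; 1; 4; 6; 1]].

(** The 7, like the 8 in [tail8], is the length reached once [word3] is put in front. *)
Definition tail7 : seq (seq nat) :=
[:: [:: 1; 4; 3; 1; 1; 5; 2; 1; 1; 6; 3; 1; 1; 2];
  [:: 1; 2; 3; 1; 1; 6; 2; 1; 1; 5; 3; 1; 1; 4];
  [:: 1; 5; 3; 1; 1; 4; 2; 1; 1; 6; 3; 1; 1; 2];
  [:: 1; 2; 3; 1; 1; 6; 2; 1; 1; 4; 3; 1; 1; 5]].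

Definition tail8 : seq (seq nat) :=
[:: [:: 1; 4; 3; 1; 1; 5; 2; 1; 1; 6; 3; 1; 1; 2];
  [:: 1; 3; 2; 1; 1; 5; 3; 1; 1; 2; 4; 1; 1; 3];
  [:: 1; 2; 6; 1; 1; 3; 2; 1; 1; 4; 5; 1; 1; 2];
  [:: 1; 3; 4; 1; 1; 2; 5; 1; 2; 3; 1; 4; 6; 1];
  [:: 1; 2; 5; 1; 1; 3; 2; 1; 1; 4; 3; 1; 2; 5]].

Fixpoint chain (s : seq (seq nat)) : bool :=
  if s is a :: s' then
    (if s' is [:: b, c, d & _] then window_ok a b c d else true) && chain s'
  else true.

(** Three further letters close up the cycle; they are taken from [w ++ w] because [w] may have only
    two. *)
Definition cyclic_ok (w : seq (seq nat)) : bool := chain (w ++ take 3 (w ++ w)).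

Lemma short_words_ok :
  all cyclic_ok [:: word2; word2 ++ word2; word5; word3; word3 ++ tail7; word3 ++ tail8].
Proof. by vm_compute. Qed.

Lemma nth_chain (s : seq (seq nat)) (t : nat) : chain s -> t + 3 < size s ->
  window_ok (nth [::] s t) (nth [::] s (t + 1)) (nth [::] s (t + 2)) (nth [::] s (t + 3)).
Proof.
elim: s t => [|a s IHs] [|t] // /andP[sok /IHs{}IHs]; last exact: IHs.
by case: s sok {IHs} => [|b [|c [|d s]]].
Qed.

Lemma chain_cons (a b c d : seq nat) (s : seq (seq nat)) :
  window_ok a b c d -> chain [:: b, c, d & s] -> chain [:: a, b, c, d & s].
Proof. by move=> h1 h2; apply/andP; split. Qed.

(** The three letters appended at the end remain [a], [b], [c], and the three new windows lie inside
    [[:: a; b; c; a; b; c]]. *)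
Lemma cyclic_ok_prepend (a b c : seq nat) (w : seq (seq nat)) :
  window_ok a b c a -> window_ok b c a b -> window_ok c a b c ->
  cyclic_ok ([:: a; b; c] ++ w) -> cyclic_ok ([:: a; b; c] ++ [:: a; b; c] ++ w).
Proof.
move=> h1 h2 h3.
have takeE s : take 3 [:: a, b, c & s] = [:: a; b; c] by rewrite /= take0.
rewrite /cyclic_ok !cat_cons !takeE => h.
by do 3 (apply: chain_cons => //).
Qed.

Lemma cyclic_ok_iter (a b c : seq nat) (w : seq (seq nat)) (k : nat) :
  window_ok a b c a -> window_ok b c a b -> window_ok c a b c ->
  cyclic_ok ([:: a; b; c] ++ w) ->
  cyclic_ok (iter k (cat [:: a; b; c]) ([:: a; b; c] ++ w)).
Proof.
move=> h1 h2 h3 w_ok; elim: k => [//|k]; rewrite -!iterSr 2!iterS.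
exact: cyclic_ok_prepend.
Qed.

Lemma word3_windows :
  [&& window_ok ladder0 ladder1 ladder2 ladder0,
      window_ok ladder1 ladder2 ladder0 ladder1
    & window_ok ladder2 ladder0 ladder1 ladder2].
Proof. by vm_compute. Qed.

Lemma cyclic_ok_word3_cat (w : seq (seq nat)) (k : nat) :
  cyclic_ok (word3 ++ w) -> cyclic_ok (iter k (cat word3) (word3 ++ w)).
Proof. by have /and3P[? ? ?] := word3_windows; exact: cyclic_ok_iter. Qed.

Lemma cyclic_word (r : nat) : 1 < r ->
  exists2 w, size w = r & cyclic_ok w.
Proof.
have /and5P[h2 h4 h5 h3 /and3P[h7 h8 _]] := short_words_ok.
have sz k w : size (iter k (cat word3) w) = 3 * k + size w.
  by elim: k => [//|k IHk]; rewrite iterS size_cat IHk mulnS addnA.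
move=> r_gt1.
have [/eqP r2|r_neq2] := boolP (r == 2); first by exists word2.
have [/eqP r4|r_neq4] := boolP (r == 4); first by exists (word2 ++ word2).
have [/eqP r5|r_neq5] := boolP (r == 5); first by exists word5.
(* Now [r] is at least 3 in residue class 0 and at least 7 in the other two, so the truncated
   subtractions below are exact. *)
have := divn_eq r 3; have := ltn_pmod r (isT : 0 < 3).
case: (r %% 3) => [|[|[|//]]] _ rE.
- exists (iter (r %/ 3 - 1) (cat word3) word3).
    by rewrite sz /=; lia.
  by have := @cyclic_ok_word3_cat [::] (r %/ 3 - 1); rewrite cats0; apply.
- exists (iter (r %/ 3 - 2) (cat word3) (word3 ++ tail7)).
    by rewrite sz /=; lia.
  exact: (@cyclic_ok_word3_cat tail7).
- exists (iter (r %/ 3 - 2) (cat word3) (word3 ++ tail8)).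
    by rewrite sz /=; lia.
  exact: (@cyclic_ok_word3_cat tail8).
Qed.

Definition cyclic_nth (w : seq (seq nat)) (t : nat) : seq nat :=
  nth [::] w (t %% size w).

Lemma cyclic_okP (w : seq (seq nat)) (t : nat) : 1 < size w -> cyclic_ok w ->
  window_ok (cyclic_nth w t) (cyclic_nth w (t + 1)) (cyclic_nth w (t + 2))
    (cyclic_nth w (t + 3)).
Proof.
move=> w_gt1 w_ok; have w_gt0 := ltnW w_gt1.
set m := t %% size w; have lt_m : m < size w by rewrite ltn_pmod.
have gE i : i <= 3 -> cyclic_nth w (t + i) = nth [::] (w ++ take 3 (w ++ w)) (m + i).
  move=> le_i3; rewrite /cyclic_nth -modnDml -/m nth_cat.
  case: ltnP => [/modn_small-> //|le_w]; rewrite nth_take; last by lia.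
  rewrite nth_cat -{1}(subnK le_w) modnDr.
  (* A window wraps a second time only if [w] has two letters. *)
  case: ltnP => [/modn_small-> //|le_w2].
  by rewrite -{1}(subnK le_w2) modnDr modn_small //; lia.
rewrite -[t in cyclic_nth w t]addn0 !gE // addn0; apply: nth_chain => //.
by rewrite size_cat size_take size_cat; case: (ltnP 3); lia.
Qed.

(** * Exhaustive search and the lower bound *)

(* [a] lists the colours already chosen, latest first; [nth [::] l c] lists the
   positions in [a] at which colour [c] would conflict with the next vertex. *)
Fixpoint search (k : nat) (tab : seq (seq (seq nat))) (a : seq nat) : bool :=
  if tab is l :: tab' then
    has (fun c => if all (fun o => nth 0 a o != c) (nth [::] l c)
                  then search k tab' (c :: a) else false) (iota 1 k)
  else true.

Definition strip_pt (n : nat) : nat * nat := ladder_pt (n %/ 14) (n %% 14).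

(** Position [o] of the search list holds the colour of vertex [(n - o).-1]. Only pairs in equal or
    adjacent ladders are kept: for [r = 2] ladders two apart coincide in the graph, so a farther
    pair could be a single vertex. *)
Definition conflicts (n c : nat) : seq nat :=
  let b := ball c (strip_pt n) in
  [seq o <- iota 0 n | (n %/ 14 <= ((n - o).-1 %/ 14).+1)
                       && (strip_pt (n - o).-1 \in b)].

(** The 56 vertices are those of four ladders of 14; the lists start at colour 0 so that a colour is
    its own index. *)
Definition conflict_table (k : nat) : seq (seq (seq nat)) :=
  [seq [seq conflicts n c | c <- iota 0 k.+1] | n <- iota 0 56].

Lemma search5 : search 5 (conflict_table 5) [::] = false.
Proof. by vm_compute. Qed.

(** Distance is defined through simple paths, whereas projection from the strip yields walks; a walk
    is first shortened to a simple path. *)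
Lemma gdist_gt_path (G : sgraph) (u v : G) (i : nat) (s : seq G) :
  gdist_gt u v i -> path adj u s -> last u s = v -> i < size s.
Proof.
move=> + us sv; rewrite -{}sv; case/shortenP: us => s' us' uniq_s' sub_s.
have le_s : size s' <= size s by apply: uniq_leq_size => //; case/andP: uniq_s'.
have s'_path : has_path (size s') u (last u s').
  by apply/existsP; exists (in_tuple s'); rewrite us' uniq_s' eqxx.
case: (ex_minnP (ex_intro (fun n => has_path n u (last u s')) _ s'_path)) => d d_path dmin.
have /gdistP dE : has_path d u (last u s') /\
    forall m, has_path m u (last u s') -> d <= m by [].
rewrite /gdist_gt dE => lt_d.
exact: leq_trans (leq_trans lt_d (dmin _ s'_path)) le_s.
Qed.

Lemma gdist_gtI (G : sgraph) (u v : G) (i : nat) :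
  (forall s, path adj u s -> last u s = v -> i < size s) -> gdist_gt u v i.
Proof.
move=> long; rewrite /gdist_gt; case E: (gdist u v) => [d|//].
have [/existsP[s /and3P[us _ /eqP sv]] _] := (gdistP _ _ _).1 E.
by rewrite -(size_tuple s); exact: long.
Qed.

(** The search succeeds along the branch that picks [col n] at every vertex [n]. The start [n] is
    arbitrary for the induction on the rest of the table. *)
Lemma search_complete (k : nat) (col : nat -> nat) :
  (forall j, 0 < col j <= k) ->
  (forall j o, o \in conflicts j (col j) -> col (j - o).-1 != col j) ->
  forall m n a, (forall o, o < n -> nth 0 a o = col (n - o).-1) ->
  search k [seq [seq conflicts j c | c <- iota 0 k.+1] | j <- iota n m] a.
Proof.
move=> col_le col_ok; elim=> [|m IHm] n a aE //=.
apply/hasP; exists (col n); first by rewrite mem_iota add1n ltnS.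
have -> : all (fun o => nth 0 a o != col n)
   (nth [::] [seq conflicts n c | c <- iota 0 k.+1] (col n)).
  have /andP[_ le_k] := col_le n.
  rewrite (nth_map 0) ?size_iota // nth_iota // add0n.
  apply/allP => o o_conf; rewrite aE ?col_ok //.
  by move: o_conf; rewrite mem_filter mem_iota add0n => /and3P[].
by apply: IHm => -[|o] lt_o //=; rewrite aE // subSS.
Qed.

Lemma strip_pt_row (n : nat) : (strip_pt n).1 < 7.
Proof. by rewrite /= -[_ < 7]ltnS; have := ltn_pmod n (isT : 0 < 14); lia. Qed.

Lemma no_packing5 (r k : nat) : 1 < r -> k < 6 -> ~~ packing_colourable (H_graph 5 r) k.
Proof.
move=> r_gt1 lt_k6; have r_gt0 := ltnW r_gt1; apply/negP => /existsP[f /andP[/forallP f_gt0 f_ok]].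
pose v n := xchoose (@lift_of_exists r 0 r_gt0 _ (strip_pt_row n)).
have vP n : lift_of 0 (v n) (strip_pt n) by exact: (xchooseP (lift_of_exists _ _ _)).
suff: search 5 (conflict_table 5) [::] by rewrite search5.
apply: (@search_complete 5 (fun n => f (v n))) => // [j|j o].
  by rewrite f_gt0 -ltnS (leq_trans (ltn_ord _)).
rewrite /conflicts mem_filter -andbA => /and3P[le_ladder conf]; rewrite mem_iota add0n => lt_o.
apply/negP => /eqP eq_f.
have [s [js sv le_s]] := path_ball r_gt0 (vP j) (vP _) conf.
have : gdist_gt (v j) (v (j - o).-1) (f (v j)).
  move/forallP: f_ok => /(_ (v j))/forallP/(_ (v (j - o).-1))/implyP; apply.
  rewrite -[f _ == _](inj_eq val_inj) /= eq_f eqxx andbT; apply/negP => /eqP vv.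
  (* If the two vertices coincided, their rows and column parities would agree, so their indices,
     lying in adjacent ladders, would differ by 14. Their columns would then differ by 2, which is
     nonzero modulo [2 * r] since [r > 1]. *)
  have lt_m : (j - o).-1 < j by lia.
  move: (vP j) (vP (j - o).-1) lt_m le_ladder; rewrite -vv; move: (j - o).-1 => m vj vm.
  have := lift_of_odd vj; rewrite (lift_of_odd vm).
  case/andP: vj vm => /eqP j1 /eqP j2 /andP[/eqP m1 /eqP m2].
  move: m1 m2; rewrite {}j1 {}j2 !muln0 !addn0.
  rewrite /strip_pt /= => row col par lt_m le_ladder.
  have par2 : j %% 14 %% 2 = m %% 14 %% 2 by lia.
  have jm : j = m + 14 by lia.
  have : 2 * (m %/ 14) + m %% 14 %% 2 + 2 == 2 * (m %/ 14) + m %% 14 %% 2 + 0 %[mod 2 * r].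
    by apply/eqP; rewrite addn0 -col jm; congr (_ %% _); lia.
  by rewrite eqn_modDl mod0n modn_small // -[X in X < _](muln1 2) ltn_mul2l.
by move/gdist_gt_path => /(_ s js sv); rewrite ltnNge le_s.
Qed.

(** * Upper bound: from good cyclic words to packing colourings *)

Lemma ball_col_le (n : nat) (p q : nat * nat) : q \in ball n p -> q.2 <= p.2 + n.
Proof.
elim: n q => [|n IHn] q; first by rewrite inE => /eqP->; rewrite addn0.
rewrite [ball _ _]/= mem_undup mem_cat => /orP[/IHn|/flatten_mapP[q' /IHn]]; first by lia.
rewrite mem_filter => le_pq' /andP[_]; rewrite !inE.
by case/or4P=> /eqP-> /=; lia.
Qed.

Lemma sub_ball (m n : nat) (p : nat * nat) : m <= n -> {subset ball m p <= ball n p}.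
Proof.
move=> le_mn q; rewrite -(subnK le_mn); elim: (n - m) => [//|k IHk] /IHk.
by rewrite addSn [ball _.+1 _]/= mem_undup mem_cat => ->.
Qed.

Lemma ladder_pt3 (i x : nat) : i < 7 -> 6 <= x < 8 ->
  exists2 n, n \in iota 0 14 & (i, x) = ladder_pt 3 n.
Proof.
move=> lt_i /andP[le_x lt_x]; exists (2 * i + (x - 6)).
  by rewrite mem_iota; lia.
by rewrite /ladder_pt; congr pair; lia.
Qed.

Lemma ladder_col_shift (a : seq nat) (i x m : nat) :
  ladder_col a (i, x + 2 * m) = ladder_col a (i, x).
Proof. by rewrite /ladder_col /=; congr (nth _ _ (_ + _)); lia. Qed.

Lemma ball_mirror (n : nat) (p q : nat * nat) :
  n <= 6 -> p.1 < 7 -> 6 <= p.2 < 8 -> q \in ball n p -> q.2 < 6 ->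
  let s := 2 * (3 - q.2 %/ 2) in (p.1, p.2 + s) \in ball n (q.1, q.2 + s).
Proof.
case: p => i x /= le_n lt_i x_bd pq lt_q; have [k k_in pE] := ladder_pt3 lt_i x_bd.
have n_in : n \in iota 0 7 by rewrite mem_iota.
have /allP/(_ n n_in)/allP/(_ k k_in) := ball_mirror_computed.
rewrite -pE => /allP/(_ q pq); rewrite leqNgt lt_q /=.
by have -> : 6 - 2 * (q.2 %/ 2) = 2 * (3 - q.2 %/ 2) by lia.
Qed.

Section UpperBound.
Variables (r : nat) (w : seq (seq nat)).
Hypotheses (r_gt1 : 1 < r) (w_size : size w = r) (w_ok : cyclic_ok w).

Lemma color_window (T : nat) (p : nat * nat) : p.1 < 7 -> 6 <= p.2 < 8 ->
  let k := ladder_col (cyclic_nth w T) p in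
  0 < k <= 6 /\ forall q : nat * nat, q \in ball k p -> 6 <= q.2 -> q != p ->
    ladder_col (cyclic_nth w (T + (q.2 %/ 2 - 3))) q != k.
Proof.
case: p => i x /= lt_i x_bd; have [n n_in pE] := ladder_pt3 lt_i x_bd.
have w_gt1 : 1 < size w by rewrite w_size.
have /allP/(_ n n_in) := cyclic_okP T w_gt1 w_ok.
rewrite -pE => /andP[k_bd /allP k_ok]; split=> // q pq le_q qp.
have := k_ok q pq; rewrite ltnNge le_q (negPf qp) /=.
have := ball_col_le pq; have /andP[_ le_k] := k_bd; move=> /= le_qk.
(* Starting in column at most 7, radius 6 reaches column 13 at most, that is, the fourth ladder of
   the window. *)
have : q.2 %/ 2 - 3 <= 3 by lia.
by case: (q.2 %/ 2 - 3) => [|[|[|[|]]]] //; rewrite addn0.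
Qed.

(** A point [q] to the left of the ladder of [p] is translated to columns 6 and 7; by [ball_mirror]
    a repeated colour would violate the window that starts at the ladder of [q]. The bound [2 < T]
    keeps the index of that ladder from being truncated. *)
Lemma color_ball (T : nat) (p q : nat * nat) : 2 < T -> p.1 < 7 -> 6 <= p.2 < 8 ->
  let k := ladder_col (cyclic_nth w T) p in
  q \in ball k p -> q != p -> ladder_col (cyclic_nth w (T + q.2 %/ 2 - 3)) q != k.
Proof.
move=> T_gt2 lt_p p_bd k pq qp.
have [/andP[k_gt0 le_k] k_ok] := color_window T lt_p p_bd.
have [le_q|lt_q] := leqP 6 q.2.
  have -> : T + q.2 %/ 2 - 3 = T + (q.2 %/ 2 - 3) by lia.
  exact: k_ok.
have := ball_mirror le_k lt_p p_bd pq lt_q; set s := 3 - q.2 %/ 2 => qp_s.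
apply/negP => /eqP eq_k.
have lt_q1 : (q.1, q.2 + 2 * s).1 < 7 := ball_row lt_p pq.
have q_bd : 6 <= (q.1, q.2 + 2 * s).2 < 8 by rewrite /s /=; lia.
have := color_window (T + q.2 %/ 2 - 3) lt_q1 q_bd.
rewrite ladder_col_shift -surjective_pairing /= eq_k => -[_ /(_ _ qp_s)].
rewrite ladder_col_shift -surjective_pairing.
have -> : T + q.2 %/ 2 - 3 + ((p.1, p.2 + 2 * s).2 %/ 2 - 3) = T.
  by rewrite /s /=; lia.
rewrite eqxx => absurd_pq; suff: false by [].
apply: absurd_pq.
  by rewrite /=; lia.
apply: contra qp => /eqP[p1 p2]; rewrite [q]surjective_pairing [p]surjective_pairing.
by rewrite p1; move/eqP: p2; rewrite eqn_add2r => /eqP->.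
Qed.

Definition word_color (u : H_graph 5 r) : nat :=
  ladder_col (cyclic_nth w (u.2 %/ 2)) (nat_of_ord u.1, nat_of_ord u.2).

(** Reduction modulo [2 * r] preserves the parity of a column and reduces its ladder index modulo
    [r = size w], so the colouring pulls back to the periodic one on the strip. *)
Lemma word_color_lift (t : nat) (u : H_graph 5 r) (p : nat * nat) : lift_of t u p ->
  word_color u = ladder_col (cyclic_nth w (p.2 %/ 2 + t)) p.
Proof.
move=> up; have odd_up := lift_of_odd up; case/andP: up => /eqP u1 /eqP u2.
rewrite /word_color /ladder_col /cyclic_nth /= u1 !modn2 odd_up w_size.
congr (nth _ (nth _ _ _) _).
rewrite u2 -(mulnC r) -modn_divl modn_mod; congr (_ %% _).
by lia.
Qed.

Lemma word_color_bounds (u : H_graph 5 r) : 0 < word_color u <= 6.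
Proof.
have lt_u1 : (nat_of_ord u.1, 6 + u.2 %% 2).1 < 7 := ltn_ord u.1.
have u_bd : 6 <= (nat_of_ord u.1, 6 + u.2 %% 2).2 < 8 by rewrite /=; lia.
have [] := color_window (u.2 %/ 2) lt_u1 u_bd.
suff -> : ladder_col (cyclic_nth w (u.2 %/ 2)) (nat_of_ord u.1, 6 + u.2 %% 2) = word_color u.
  by [].
by rewrite /word_color /ladder_col /=; congr (nth _ _ (_ + _)); lia.
Qed.

Lemma word_color_packing (u v : H_graph 5 r) : u != v -> word_color u = word_color v ->
  gdist_gt u v (word_color u).
Proof.
move=> uv eq_uv; apply: gdist_gtI => s us sv; rewrite ltnNge; apply/negP => le_s.
have r_gt0 := ltnW r_gt1; have /andP[_ le_6] := word_color_bounds u.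
(* The base point sits in column 6 or 7, leaving room for six steps to the left. The full turns
   [2 * r] in [t] make the subtraction of 3 exact and provide the bound [T_gt2]. *)
pose p := (nat_of_ord u.1, 6 + u.2 %% 2); pose t := u.2 %/ 2 + 2 * r - 3.
have up : lift_of t u p.
  rewrite /lift_of /= eqxx /=.
  have -> : 6 + u.2 %% 2 + 2 * t = u.2 + 2 * (2 * r) by rewrite /t; lia.
  by rewrite addnC modnMDl modn_small.
have [|q pq vq] := ball_path r_gt0 up _ us.
  exact: leq_trans le_s (leq_trans le_6 (leq_addr _ _)).
have qp : q != p.
  by apply: contra uv => /eqP qp; rewrite sv qp in vq; rewrite (lift_of_inj up vq).
have uE := word_color_lift up; have vE := word_color_lift vq.
have T_gt2 : 2 < p.2 %/ 2 + t by rewrite /p /t /=; lia.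
have p_bd : 6 <= p.2 < 8 by rewrite /p /=; lia.
have := color_ball T_gt2 (lift_of_lt up) p_bd; rewrite -uE => /(_ q (sub_ball le_s pq) qp).
have -> : p.2 %/ 2 + t + q.2 %/ 2 - 3 = q.2 %/ 2 + t by rewrite /p /=; lia.
by rewrite -vE sv eq_uv eqxx.
Qed.

End UpperBound.

Lemma packing6 (r : nat) : 1 < r -> packing_colourable (H_graph 5 r) 6.
Proof.
move=> r_gt1; have [w w_size w_ok] := cyclic_word r_gt1.
have bd := word_color_bounds r_gt1 w_size w_ok.
pose f := [ffun u : H_graph 5 r => inord (word_color w u) : 'I_7].
have fE u : f u = word_color w u :> nat.
  by rewrite ffunE inordK //; have /andP[] := bd u.
apply/existsP; exists f; apply/andP; split.
  by apply/forallP => u; rewrite fE; have /andP[] := bd u.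
apply/forallP => u; apply/forallP => v; apply/implyP => /andP[uv /eqP eq_f].
rewrite fE; apply: word_color_packing => //.
by rewrite -!fE eq_f.
Qed.

Unset Implicit Arguments.

Theorem theorem19 (r : nat) (hr : 2 <= r) :
  packing_chromatic_number (H_graph 5 r) = 6.
Proof.
rewrite /packing_chromatic_number; case: ex_minnP => k k_col k_min.
apply/eqP; rewrite eqn_leq k_min ?packing6 //= leqNgt.
by apply: contraL k_col; exact: no_packing5.
Qed.
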